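(* Let $A \in \mathbb{R}^{n \times n}$ be symmetric positive definite. The value of $\Delta t > 0$ that minimizes the spectral radius $\rho(I - 2\Delta t A)$ is $$\Delta t^* = \frac{1}{\lambda_{\max}(A) + \lambda_{\min}(A)},$$ and the corresponding spectral radius is $$\rho(I - 2\Delta t^* A) = \frac{\kappa(A) - 1}{\kappa(A) + 1},$$ where $\kappa(A) = \lambda_{\max}(A)/\lambda_{\min}(A)$ is the condition number of $A$.
   Context: $I$ is the $n\times n$ identity matrix, $\rho(\cdot)$ is the spectral radius, and $\lambda_{\max}(A)$, $\lambda_{\min}(A)$ are the largest and smallest eigenvalues of $A$. The quantity $\Delta t$ is the learning rate (step size) of the iteration $\Sigma_{i+1} = \Sigma_i - 2\Delta t(\Sigma_i A - I)$. *)

(* Defs.v *)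
From mathcomp Require Import all_boot all_order all_algebra.
From mathcomp Require Import all_classical all_reals.
From mathcomp Require Export complex.

Set Implicit Arguments.
Unset Strict Implicit.
Unset Printing Implicit Defensive.

Import Order.TTheory GRing.Theory Num.Theory.
Local Open Scope classical_set_scope.
Local Open Scope ring_scope.

Section Defs.
Variables (R : realType) (n : nat).
Implicit Types A : 'M[R]_n.

Definition posdef A : Prop :=
  A \is symmetricmx /\
  (forall x : 'cV[R]_n, x != 0 -> 0 < (x^T *m A *m x) 0 0).

(* For 0 < n the set of complex eigenvalues is finite and nonempty, so this
   supremum is the maximum of the moduli. *)
Definition spectral_radius A : R :=
  sup [set ComplexField.Normc.normc z | z in
        [set z : R[i] | eigenvalue (map_mx (real_complex R) A) z]].

(* The spectrum below consists of the real eigenvalues; for A symmetric and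
   0 < n it is the whole spectrum, finite and nonempty, so that sup and inf
   are the largest and the smallest eigenvalue. *)
Definition lambda_max A : R := sup [set a : R | eigenvalue A a].

Definition lambda_min A : R := inf [set a : R | eigenvalue A a].

Definition condition_number A : R := lambda_max A / lambda_min A.

End Defs.

(* Main.v *)
Require Import Defs.
From mathcomp Require Import all_boot all_order all_algebra.
From mathcomp Require Import all_classical all_reals.
From mathcomp Require Import ring lra.

(** Write [l] and [L] for the extreme eigenvalues of [A].  As [A] is symmetric,
    its complex eigenvalues are real, so the spectrum of [1 - c A] is the image
    of the real spectrum of [A] under [a |-> 1 - c a].  This map is affine,
    hence its modulus is largest at an extreme eigenvalue, and
      [rho (1 - 2 d A) = max |1 - 2 d L| |1 - 2 d l|]
    ([spectral_radius_affine]).  What remains is a minimax problem in the real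
    variable [d].  A value at most [(L - l) / (L + l)] forces [d >= 1 / (L + l)]
    through [1 - 2 d l] and [d <= 1 / (L + l)] through [2 d L - 1], while at
    [d = 1 / (L + l)] the two terms are opposite and equal to that value in
    modulus ([minimax_le_unique], [minimax_at_optimum]).  Positive
    definiteness supplies [0 < l].

    Since [lambda_max] and [lambda_min] are a supremum and an infimum, it must
    be checked that they are attained: the spectrum is finite, being the root
    set of the characteristic polynomial, and nonempty, because the complex
    field is algebraically closed and the roots found there are real
    ([symmetric_spectrum]). *)

Import Order.TTheory GRing.Theory Num.Theory.
Local Open Scope classical_set_scope.
Local Open Scope ring_scope.

(** * Attained extrema *)

Lemma sup_eq_max (R : realType) (E : set R) (m : R) :
  E m -> ubound E m -> sup E = m.
Proof.
move=> Em ubm; apply/le_anti/andP; split.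
  by apply: ge_sup => //; exists m.
by apply: ub_le_sup => //; exists m.
Qed.

Lemma inf_eq_min (R : realType) (E : set R) (m : R) :
  E m -> lbound E m -> inf E = m.
Proof.
move=> Em lbm; apply/le_anti/andP; split.
  by apply: ge_inf => //; exists m.
by apply: lb_le_inf => //; exists m.
Qed.

Lemma seq_has_max (R : realType) (s : seq R) (x : R) :
  x \in s -> exists2 m, m \in s & {in s, forall y, y <= m}.
Proof.
move=> xs.
have [m _ mP] := @arg_maxP _ _ _ (SeqSub xs) xpredT (@ssval R s) isT.
exists (ssval m); first exact: ssvalP.
by move=> y ys; exact: (mP (SeqSub ys)).
Qed.

Lemma seq_has_min (R : realType) (s : seq R) (x : R) :
  x \in s -> exists2 m, m \in s & {in s, forall y, m <= y}.
Proof.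
move=> xs.
have [m _ mP] := @arg_minP _ _ _ (SeqSub xs) xpredT (@ssval R s) isT.
exists (ssval m); first exact: ssvalP.
by move=> y ys; exact: (mP (SeqSub ys)).
Qed.

(** * Spectra of real symmetric matrices *)

Lemma symmetricmx_tr (R : realType) (n : nat) (A : 'M[R]_n) :
  A \is symmetricmx -> A^T = A.
Proof.
move=> /is_hermitianmxP Asym; rewrite [RHS]Asym expr0 scale1r.
by apply/matrixP => i j; rewrite !mxE.
Qed.

Lemma mul_tr_ge0 (R : realType) (n : nat) (v : 'rV[R]_n) :
  0 <= (v *m v^T) 0 0.
Proof. by rewrite mxE sumr_ge0 // => i _; rewrite mxE -expr2 sqr_ge0. Qed.

Lemma mul_tr_eq0 (R : realType) (n : nat) (v : 'rV[R]_n) :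
  (v *m v^T) 0 0 = 0 -> v = 0.
Proof.
rewrite mxE => /eqP; rewrite psumr_eq0; last first.
  by move=> i _; rewrite mxE -expr2 sqr_ge0.
move=> /allP v0; apply/rowP => i; rewrite [RHS]mxE.
have := v0 i (mem_index_enum i).
by rewrite mxE mulf_eq0 orbb => /eqP.
Qed.

(** Let [(x + i y) A = (a + i b) (x + i y)] with [x], [y], [a], [b] real.  The
    difference of [y A x^T] and [x A y^T] is [b (|x|^2 + |y|^2)], and it
    vanishes by symmetry. *)
Lemma symmetric_eigenvalue_real (R : realType) (n : nat) (A : 'M[R]_n)
    (z : R[i]) :
  A^T = A -> eigenvalue (map_mx (real_complex R) A) z -> complex.Im z = 0.
Proof.
move=> Asym /eigenvalueP [v vA v_neq0].
pose x := map_mx (@complex.Re R) v; pose y := map_mx (@complex.Im R) v.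
have xA : x *m A = complex.Re z *: x - complex.Im z *: y.
  apply/rowP => j; have /rowP /(_ j) /(congr1 (@complex.Re R)) := vA.
  rewrite !mxE (raddf_sum (@complex.Re R : Rcomplex R -> R)) => E.
  transitivity (complex.Re (z * v 0 j)); last first.
    by case: z {vA E} => a b; case: (v 0 j).
  rewrite -E; apply: eq_bigr => k _; rewrite !mxE.
  by case: (v 0 k) => a b /=; rewrite mulr0 subr0.
have yA : y *m A = complex.Im z *: x + complex.Re z *: y.
  apply/rowP => j; have /rowP /(_ j) /(congr1 (@complex.Im R)) := vA.
  rewrite !mxE (raddf_sum (@complex.Im R : Rcomplex R -> R)) => E.
  transitivity (complex.Im (z * v 0 j)); last first.
    by case: z {vA xA E} => a b; case: (v 0 j) => c d /=; rewrite addrC.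
  rewrite -E; apply: eq_bigr => k _; rewrite !mxE.
  by case: (v 0 k) => a b /=; rewrite mulr0 add0r.
have swap (B : 'M[R]_1) : B 0 0 = B^T 0 0 by rewrite mxE.
have yx : (y *m x^T) 0 0 = (x *m y^T) 0 0.
  by rewrite swap trmx_mul trmxK.
have := swap (x *m A *m y^T).
rewrite !trmx_mul trmxK Asym mulmxA xA yA !mulmxDl mulNmx -!scalemxAl.
have entryD (B C : 'M[R]_1) : (B + C) 0 0 = B 0 0 + C 0 0 by rewrite mxE.
have entryN (B : 'M[R]_1) : (- B) 0 0 = - B 0 0 by rewrite mxE.
have entryZ k (B : 'M[R]_1) : (k *: B) 0 0 = k * B 0 0 by rewrite mxE.
rewrite !(entryD, entryN, entryZ) yx => E.
have {}E : complex.Im z * ((x *m x^T) 0 0 + (y *m y^T) 0 0) = 0 by lra.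
move/eqP: E; rewrite mulf_eq0 => /orP [/eqP //|].
rewrite paddr_eq0 ?mul_tr_ge0 // => /andP [/eqP x0 /eqP y0].
case/eqP: v_neq0; apply/rowP => j; rewrite mxE.
have /rowP /(_ j) := mul_tr_eq0 _ _ _ x0.
have /rowP /(_ j) := mul_tr_eq0 _ _ _ y0.
by rewrite !mxE; case: (v 0 j) => a b /= -> ->.
Qed.

Lemma symmetric_complex_eigenvalueP (R : realType) (n : nat) (A : 'M[R]_n)
    (z : R[i]) :
  A^T = A ->
  eigenvalue (map_mx (real_complex R) A) z <->
  exists2 a, eigenvalue A a & z = real_complex R a.
Proof.
move=> Asym; split=> [Az|[a Aa ->]]; last by rewrite eigenvalue_map.
have z0 := symmetric_eigenvalue_real _ _ _ _ Asym Az.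
have zE : z = real_complex R (complex.Re z) by case: z z0 {Az} => a b /= ->.
by exists (complex.Re z) => //; rewrite zE eigenvalue_map in Az.
Qed.

(** Over the complex field the characteristic polynomial splits into [n]
    linear factors; by symmetry its roots are real, so taking real parts
    lists the real spectrum, and [0 < n] makes the list nonempty. *)
Lemma symmetric_spectrum (R : realType) (n : nat) (A : 'M[R]_n) :
  (0 < n)%N -> A^T = A ->
  exists s : seq R, (exists x, x \in s) /\
    (forall a, eigenvalue A a = (a \in s)).
Proof.
move=> n_gt0 Asym; pose AC := map_mx (real_complex R) A.
have [r rE] := closed_field_poly_normal (char_poly AC).
have ACr z : eigenvalue AC z = (z \in r).
  by rewrite eigenvalue_root_char rE (monicP (char_poly_monic _)) scale1r
     root_prod_XsubC.
have inE a : eigenvalue A a = (a \in map (@complex.Re R) r).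
  apply/idP/mapP => [Aa|[z zr ->]].
    by exists (real_complex R a); rewrite // -ACr eigenvalue_map.
  rewrite -ACr in zr.
  by have [b Ab ->] := (symmetric_complex_eigenvalueP _ _ _ _ Asym).1 zr.
exists (map (@complex.Re R) r); split => //.
case: r rE {ACr inE} => [|z r] rE; last first.
  by exists (complex.Re z); rewrite mem_head.
have := size_char_poly AC.
rewrite rE (monicP (char_poly_monic _)) scale1r big_nil size_poly1 => -[n0].
by rewrite -n0 in n_gt0.
Qed.

Lemma symmetric_lambda_max (R : realType) (n : nat) (A : 'M[R]_n) :
  (0 < n)%N -> A^T = A ->
  eigenvalue A (lambda_max A) /\
  forall a, eigenvalue A a -> a <= lambda_max A.
Proof.
move=> n_gt0 Asym; have [s [[x xs] sE]] := symmetric_spectrum _ _ _ n_gt0 Asym.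
have [m ms mP] := seq_has_max _ _ _ xs.
have -> : lambda_max A = m.
  by apply: sup_eq_max => [|a] /=; rewrite sE //; exact: mP.
by split=> [|a]; rewrite sE //; exact: mP.
Qed.

Lemma symmetric_lambda_min (R : realType) (n : nat) (A : 'M[R]_n) :
  (0 < n)%N -> A^T = A ->
  eigenvalue A (lambda_min A) /\
  forall a, eigenvalue A a -> lambda_min A <= a.
Proof.
move=> n_gt0 Asym; have [s [[x xs] sE]] := symmetric_spectrum _ _ _ n_gt0 Asym.
have [m ms mP] := seq_has_min _ _ _ xs.
have -> : lambda_min A = m.
  by apply: inf_eq_min => [|a] /=; rewrite sE //; exact: mP.
by split=> [|a]; rewrite sE //; exact: mP.
Qed.

Lemma posdef_eigenvalue_gt0 (R : realType) (n : nat) (A : 'M[R]_n) (a : R) :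
  posdef A -> eigenvalue A a -> 0 < a.
Proof.
move=> [_ Apos] /eigenvalueP [v vA v_neq0].
have vT_neq0 : v^T != 0 by rewrite trmx_eq0.
have := Apos _ vT_neq0.
rewrite trmxK vA -scalemxAl mxE => /[dup] av_gt0.
rewrite pmulr_lgt0 // lt_neqAle mul_tr_ge0 andbT eq_sym.
by apply: contraTneq av_gt0 => ->; rewrite mulr0 ltxx.
Qed.

(** * The spectral radius of the iteration matrix *)

Lemma eigenvalue_affine (F : fieldType) (n : nat) (A : 'M[F]_n) (c a : F) :
  c != 0 -> eigenvalue (1%:M - c *: A) (1 - c * a) = eigenvalue A a.
Proof.
move=> c_neq0.
have E (v : 'rV_n) :
    (v *m (1%:M - c *: A) = (1 - c * a) *: v) <-> (v *m A = a *: v).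
  rewrite mulmxBr mulmx1 -scalemxAr scalerBl scale1r -scalerA.
  by split=> [/addrI /oppr_inj /(scalerI c_neq0)|->].
by apply/eigenvalueP/eigenvalueP => -[v vP v0]; exists v => //; apply/E.
Qed.

Lemma normc_real (R : realType) (a : R) :
  ComplexField.Normc.normc (real_complex R a) = `|a|.
Proof. by rewrite /= expr0n addr0 sqrtr_sqr. Qed.

(** A convex function on an interval is largest at an endpoint; which endpoint
    dominates depends on the signs of [c] and of [1 - c a]. *)
Lemma ler_norm_affine (R : realType) (c l a L : R) :
  l <= a -> a <= L ->
  `|1 - c * a| <= Num.max `|1 - c * L| `|1 - c * l|.
Proof.
move=> la aL.
suff [E|E] : (`|1 - c * a| <= `|1 - c * L| \/ `|1 - c * a| <= `|1 - c * l|).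
- by rewrite le_max E.
- by rewrite le_max E orbT.
have [c0|c0] := leP 0 c; have [s0|s0] := leP 0 (1 - c * a).
- right; rewrite ger0_norm //; apply: le_trans (ler_norm _); nra.
- left; rewrite ltr0_norm // -normrN; apply: le_trans (ler_norm _); nra.
- left; rewrite ger0_norm //; apply: le_trans (ler_norm _); nra.
- right; rewrite ltr0_norm // -normrN; apply: le_trans (ler_norm _); nra.
Qed.

(** Among the numbers [1 - c a], the largest modulus occurs at an end of the
    spectrum, both ends of which are eigenvalues. *)
Lemma spectral_radius_affine (R : realType) (n : nat) (A : 'M[R]_n) (c : R) :
  (0 < n)%N -> A^T = A -> c != 0 ->
  spectral_radius (1%:M - c *: A) =
  Num.max `|1 - c * lambda_max A| `|1 - c * lambda_min A|.
Proof.
move=> n_gt0 Asym c_neq0.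
have Bsym : (1%:M - c *: A)^T = 1%:M - c *: A.
  by rewrite linearB linearZ /= trmx1 Asym.
have [AL maxL] := symmetric_lambda_max _ _ _ n_gt0 Asym.
have [Al minl] := symmetric_lambda_min _ _ _ n_gt0 Asym.
have mem a : eigenvalue A a ->
    [set ComplexField.Normc.normc z | z in
       [set z | eigenvalue (map_mx (real_complex R) (1%:M - c *: A)) z]]
    `|1 - c * a|.
  move=> Aa; exists (real_complex R (1 - c * a)); last exact: normc_real.
  by rewrite /= eigenvalue_map eigenvalue_affine.
apply: sup_eq_max; first by case: leP => _; apply: mem.
move=> _ [z /= Bz <-].
have [b Bb ->] := (symmetric_complex_eigenvalueP _ _ _ _ Bsym).1 Bz.
(* the eigenvalue [b] of [1 - c A] comes from [(1 - b) / c] of [A] *)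
have bE : b = 1 - c * ((1 - b) / c) by field.
move: Bb; rewrite normc_real bE eigenvalue_affine // => Aa.
by apply: ler_norm_affine; [exact: minl | exact: maxL].
Qed.

(** * The scalar minimax problem *)

Lemma minimax_at_optimum (R : realType) (l L : R) :
  0 < l -> l <= L ->
  Num.max `|1 - 2 * (1 / (L + l)) * L| `|1 - 2 * (1 / (L + l)) * l| =
  (L - l) / (L + l).
Proof.
move=> l_gt0 lL; have s_gt0 : 0 < L + l by lra.
have -> : 1 - 2 * (1 / (L + l)) * L = - ((L - l) / (L + l)).
  by field; rewrite gt_eqF.
have -> : 1 - 2 * (1 / (L + l)) * l = (L - l) / (L + l).
  by field; rewrite gt_eqF.
by rewrite normrN maxxx ger0_norm // divr_ge0 ?subr_ge0 // ltW.
Qed.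

(** Put [m = (L - l) / (L + l)].  As [1 - m = 2 l / (L + l)] and
    [1 + m = 2 L / (L + l)], the inequalities [1 - 2 d l <= m] and
    [2 d L - 1 <= m] bound [d] from below and from above by [1 / (L + l)].
    Minimality follows as well: a value below [m] would also force
    [d = 1 / (L + l)], where the value is [m]. *)
Lemma minimax_le_unique (R : realType) (l L d : R) :
  0 < l -> l <= L ->
  Num.max `|1 - 2 * d * L| `|1 - 2 * d * l| <= (L - l) / (L + l) ->
  d = 1 / (L + l).
Proof.
move=> l_gt0 lL; have s_gt0 : 0 < L + l by lra.
rewrite ge_max !ler_norml => /andP [/andP [lo _] /andP [_ hi]].
move: lo hi; rewrite -mulNr ler_pdivrMr // ler_pdivlMr // => lo hi.
have up : d * (L + l) <= 1 by nra.
have dn : 1 <= d * (L + l) by nra.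
by rewrite -[LHS](mulfK (lt0r_neq0 s_gt0)); congr (_ / _); lra.
Qed.

Theorem theorem0p3 (R : realType) (n : nat) (A : 'M[R]_n)
    (n_gt0 : (0 < n)%N) (A_posdef : posdef A) :
  let rho (dt : R) := spectral_radius (1%:M - (2 * dt) *: A) in
  let dt_star := 1 / (lambda_max A + lambda_min A) in
  (forall dt : R,
      (0 < dt /\ forall s : R, 0 < s -> rho dt <= rho s) <-> dt = dt_star) /\
  rho dt_star = (condition_number A - 1) / (condition_number A + 1).
Proof.
move=> rho dt_star.
have Asym := symmetricmx_tr _ _ _ A_posdef.1.
have [AL maxL] := symmetric_lambda_max _ _ _ n_gt0 Asym.
have [Al minl] := symmetric_lambda_min _ _ _ n_gt0 Asym.
have l_gt0 := posdef_eigenvalue_gt0 _ _ _ _ A_posdef Al.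
have lL := maxL _ Al.
rewrite /condition_number; rewrite {}/dt_star.
set l := lambda_min A in l_gt0 lL *; set L := lambda_max A in lL *.
have s_gt0 : 0 < L + l by lra.
have rhoE d : 0 < d -> rho d = Num.max `|1 - 2 * d * L| `|1 - 2 * d * l|.
  move=> d_gt0; apply: spectral_radius_affine => //.
  by rewrite gt_eqF ?mulr_gt0.
have star_gt0 : 0 < 1 / (L + l) by rewrite divr_gt0.
have rho_star : rho (1 / (L + l)) = (L - l) / (L + l).
  by rewrite rhoE // minimax_at_optimum.
split; last by rewrite rho_star; field; rewrite !gt_eqF.
move=> dt; split=> [[dt_gt0 /(_ _ star_gt0)]|->].
  by rewrite rho_star rhoE //; exact: minimax_le_unique.
split=> [|s s_pos]; first exact: star_gt0.
have [_|s_lt] := leP (rho (1 / (L + l))) (rho s); first by [].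
have sE : s = 1 / (L + l).
  by apply: minimax_le_unique l_gt0 lL _; rewrite -rhoE // -rho_star ltW.
by rewrite sE ltxx in s_lt.
Qed.
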